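(* Let $I=(a,b)$ be a finite interval and let $f$ be absolutely monotone in $I$. Then $f$ can be extended analytically into the complex plane ($z=x+iy$) so that the extended function $f(z)$ is analytic in the disc $|z-a|<b-a$ and is absolutely monotone in $[a,b)$. If $I=(-\infty,b)$ with $b$ finite and $f$ is absolutely monotone in $I$, then $f$ extends to a function $f(z)$ analytic in the half-plane $\mathrm{Re}\,z<b$. If $I=(a,\infty)$ with $a$ finite and $f$ is absolutely monotone in $I$, then $f$ extends to a function $f(z)$ analytic in the whole plane. If $I=(-\infty,\infty)$ and $f$ is absolutely monotone in $I$, then $f$ extends to a function $f(z)$ analytic in the whole plane.
   Context: A function $f:I\to\mathbb{R}$ on an interval $I\subseteq\mathbb{R}$ is called absolutely monotone if it has derivatives of all orders and $f^{(n)}(x)\ge 0$ for all $n=0,1,2,\ldots$ and all $x\in I$. *)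

(* Defs.v *)
From Stdlib Require Import Reals.
From Coquelicot Require Import Coquelicot.
Open Scope R_scope.

(* The relative derivative [D_in] is one-sided at an endpoint belonging to [I].
   [I] is meant to be a nondegenerate interval; [f] is only constrained on [I]. *)
Definition absolutely_monotone (I : R -> Prop) (f : R -> R) : Prop :=
  exists D : nat -> R -> R,
    (forall x, I x -> D O x = f x) /\
    (forall n x, I x -> D_in (D n) (D (S n)) I x) /\
    (forall n x, I x -> 0 <= D n x).

Definition analytic_at (F : C -> C) (z0 : C) : Prop :=
  exists c : nat -> C,
    locally z0 (fun z : C =>
      is_pseries (K := C_AbsRing) (V := C_NormedModule) c (z - z0)%C (F z)).

Definition analytic_on (U : C -> Prop) (F : C -> C) : Prop :=
  forall z, U z -> analytic_at F z.

Definition real_restriction (I : R -> Prop) (F : C -> C) (f : R -> R) : Prop :=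
  forall x, I x -> F (RtoC x) = RtoC (f x).

(* Main.v *)
(* Let [R_N] be the Taylor remainder of [f] at [a]. Since [R_{N+1}' = R_N] for the
   sequence of derivatives shifted by one, the mean value theorem gives by
   induction [R_N >= 0] and [R_N (a + l u) <= l^N R_N (a + u) <= l^N f (a + u)] for
   [0 <= l <= 1]; hence [R_N -> 0] and [f] is the sum of its Taylor series at [a],
   which therefore also converges in the complex disc of radius [b - a].

   Re-expanding the complex series at [z] in powers of [z' - z] leaves a remainder
   whose terms are dominated, all coefficients being nonnegative, by those of the
   same remainder at the real points [a + |z - a|] and [a + |z - a| + |z' - z|],
   which tends to [0] by the real result. This gives analyticity, and also shows
   that the series at different real centres agree; the unbounded cases follow by
   moving the centre. At a left endpoint the derivatives extend by their infima. *)

Require Import Defs.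
From Stdlib Require Import Reals Factorial Lra Lia.
From Coquelicot Require Import Coquelicot.
Open Scope R_scope.

(** * Sequences of derivatives and their Taylor remainders *)

(** At [a] only continuity is asked, as the mean value theorem needs no more there. Since
    [continuity_pt] is two-sided, values just left of [a] matter too. *)
Definition abs_mono_seq (a b : R) (D : nat -> R -> R) : Prop :=
  forall n x, a <= x < b ->
    0 <= D n x /\ continuity_pt (D n) x /\
    (a < x -> is_derive (D n) x (D (S n) x)).

Lemma abs_mono_seq_tail (a b : R) (D : nat -> R -> R) (m : nat) :
  abs_mono_seq a b D -> abs_mono_seq a b (fun n => D (m + n)%nat).
Proof.
intros HD n x Hx; destruct (HD (m + n)%nat x Hx) as (H1 & H2 & H3).
replace (m + S n)%nat with (S (m + n)) by lia; auto.
Qed.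

Lemma abs_mono_seq_sub (a b c : R) (D : nat -> R -> R) :
  abs_mono_seq a b D -> a <= c -> abs_mono_seq c b D.
Proof.
intros HD Hc n x Hx; destruct (HD n x ltac:(lra)) as (H1 & H2 & H3).
split; [exact H1|split; [exact H2|intros; apply H3; lra]].
Qed.

Lemma le_of_is_derive_nonneg (f df : R -> R) (u : R) :
  0 <= u ->
  (forall t, 0 <= t <= u -> continuity_pt f t) ->
  (forall t, 0 < t < u -> is_derive f t (df t)) ->
  (forall t, 0 <= t <= u -> 0 <= df t) ->
  f 0 <= f u.
Proof.
intros Hu Hc Hd Hp.
destruct (MVT_gen f 0 u df) as (c & Hc1 & Hc2).
- intros x; rewrite Rmin_left, Rmax_right by lra; auto.
- intros x; rewrite Rmin_left, Rmax_right by lra; auto.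
- rewrite Rmin_left, Rmax_right in Hc1 by lra.
  pose proof (Rmult_le_pos _ _ (Hp c Hc1) Hu); lra.
Qed.

(** The terms removed are those of orders [0] to [N - 1]. *)
Fixpoint taylor_rem (N : nat) (D : nat -> R -> R) (a x : R) : R :=
  match N with
  | O => D O x
  | S N => taylor_rem N D a x - D N a / INR (fact N) * (x - a) ^ N
  end.

Lemma taylor_rem_at_center (N : nat) (D : nat -> R -> R) (a : R) :
  taylor_rem (S N) D a a = 0.
Proof.
induction N.
- simpl; field.
- change (taylor_rem (S N) D a a - D (S N) a / INR (fact (S N)) * (a - a) ^ S N = 0).
  rewrite IHN, Rminus_diag, pow_i by lia; ring.
Qed.

(** Differentiation turns [(x - a)^k / k!] into its predecessor and kills the constant term: the
    order drops by one and the sequence shifts. *)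
Lemma is_derive_taylor_rem (N : nat) (D : nat -> R -> R) (a x : R) :
  is_derive (D O) x (D 1%nat x) ->
  is_derive (taylor_rem (S N) D a) x (taylor_rem N (fun n => D (S n)) a x).
Proof.
intros HD; induction N.
- simpl. evar_last.
  + eapply @is_derive_minus; [exact HD|apply is_derive_const].
  + apply @minus_zero_r.
- change (is_derive (fun x => taylor_rem (S N) D a x
      - D (S N) a / INR (fact (S N)) * (x - a) ^ S N) x
    (taylor_rem N (fun n => D (S n)) a x - D (S N) a / INR (fact N) * (x - a) ^ N)).
  eapply @is_derive_minus; [exact IHN|].
  rewrite fact_simpl, mult_INR.
  pose proof (INR_fact_neq_0 N) as Hf. pose proof (not_0_INR (S N) ltac:(lia)) as HN.
  revert Hf HN; generalize (INR (fact N)); intros k Hf HN.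
  evar_last.
  + apply is_derive_scal, is_derive_pow.
    apply @is_derive_minus; [apply is_derive_id|apply is_derive_const].
  + unfold minus, plus, opp, zero, one; simpl pred; cbn -[INR pow].
    field; auto.
Qed.

Lemma continuity_pt_taylor_rem (N : nat) (D : nat -> R -> R) (a x : R) :
  continuity_pt (D O) x -> continuity_pt (taylor_rem N D a) x.
Proof.
intros HD; induction N; [exact HD|].
apply continuity_pt_minus; [exact IHN|].
apply derivable_continuous_pt; reg.
Qed.

(** * Convergence of the real Taylor series *)

Section Bernstein.
Variables a b : R.

(** The induction lets [D] vary, because the derivative of a remainder is a remainder of the shifted
    sequence. *)
Lemma taylor_rem_nonneg (N : nat) :
  forall D, abs_mono_seq a b D -> forall x, a <= x < b -> 0 <= taylor_rem N D a x.
Proof.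
induction N as [|N IH]; intros D HD x Hx; [apply (HD O x Hx)|].
pose (f := fun t => taylor_rem (S N) D a (a + t)).
assert (Hle : f 0 <= f (x - a)).
{ apply (le_of_is_derive_nonneg f (fun t => taylor_rem N (fun n => D (S n)) a (a + t)));
    [lra| | |].
  - intros t Ht. unfold f.
    apply (continuity_pt_comp (fun t => a + t) (taylor_rem (S N) D a)); [reg|].
    apply continuity_pt_taylor_rem, HD; lra.
  - intros t Ht. unfold f.
    evar_last; [apply (is_derive_comp (taylor_rem (S N) D a) (fun t => a + t))|].
    + apply is_derive_taylor_rem; apply HD; lra.
    + auto_derive; auto.
    + apply @scal_one.
  - intros t Ht; apply IH; [|lra].
    exact (abs_mono_seq_tail a b D 1 HD). }
unfold f in Hle. rewrite Rplus_0_r, taylor_rem_at_center in Hle.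
now replace (a + (x - a)) with x in Hle by ring.
Qed.

(* That is, [taylor_rem N D a x / (x - a) ^ N] is nondecreasing in [x]. *)
Lemma taylor_rem_scale (N : nat) :
  forall D, abs_mono_seq a b D -> forall u l, 0 <= u -> a + u < b -> 0 <= l <= 1 ->
  taylor_rem N D a (a + l * u) <= l ^ N * taylor_rem N D a (a + u).
Proof.
induction N as [|N IH]; intros D HD u l Hu Hub Hl.
- simpl. rewrite Rmult_1_l.
  assert (H0 : 0 <= l * u <= u) by nra.
  pose proof (le_of_is_derive_nonneg (fun t => D O (a + (l * u + t)))
    (fun t => D 1%nat (a + (l * u + t))) (u - l * u)) as Hle.
  simpl in Hle. rewrite Rplus_0_r in Hle.
  replace (l * u + (u - l * u)) with u in Hle by ring.
  apply Hle; [lra| | |].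
  + intros t Ht.
    apply (continuity_pt_comp (fun t => a + (l * u + t)) (D O)); [reg|].
    apply HD; lra.
  + intros t Ht.
    evar_last; [apply (is_derive_comp (D O) (fun t => a + (l * u + t)))|].
    * apply HD; lra.
    * auto_derive; auto.
    * apply @scal_one.
  + intros t Ht; apply HD; lra.
(* For [l = 0] the point [a + l * t] stays at [a], where no derivative is available. *)
- destruct (Req_dec l 0) as [->|Hl0].
  { rewrite Rmult_0_l, Rplus_0_r, taylor_rem_at_center, pow_i by lia; lra. }
  (* [f] vanishes at [0], and its derivative is [l] times a difference that the induction hypothesis
     for the shifted sequence makes nonnegative. *)
  pose (f := fun t => l ^ S N * taylor_rem (S N) D a (a + t)
                      - taylor_rem (S N) D a (a + l * t)).
  assert (Hle : f 0 <= f u).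
  { apply (le_of_is_derive_nonneg f (fun t =>
      l * (l ^ N * taylor_rem N (fun n => D (S n)) a (a + t)
           - taylor_rem N (fun n => D (S n)) a (a + l * t)))); [lra| | |].
    - intros t Ht. unfold f.
      apply continuity_pt_minus.
      + apply continuity_pt_scal.
        apply (continuity_pt_comp (fun t => a + t) (taylor_rem (S N) D a)); [reg|].
        apply continuity_pt_taylor_rem, HD; lra.
      + apply (continuity_pt_comp (fun t => a + l * t) (taylor_rem (S N) D a)); [reg|].
        apply continuity_pt_taylor_rem, HD; nra.
    - intros t Ht. unfold f.
      evar_last; [eapply @is_derive_minus|].
      + apply is_derive_scal.
        apply (is_derive_comp (taylor_rem (S N) D a) (fun t => a + t)).
        * apply is_derive_taylor_rem; apply HD; lra.
        * auto_derive; auto.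
      + apply (is_derive_comp (taylor_rem (S N) D a) (fun t => a + l * t)).
        * apply is_derive_taylor_rem; apply HD; nra.
        * auto_derive; auto.
      + unfold minus, plus, opp, scal; simpl; unfold mult; simpl; ring.
    - intros t Ht.
      apply Rmult_le_pos; [lra|]. apply Rge_le, Rge_minus, Rle_ge.
      apply IH; try lra. exact (abs_mono_seq_tail a b D 1 HD). }
  unfold f in Hle.
  rewrite Rmult_0_r, Rplus_0_r, taylor_rem_at_center in Hle. lra.
Qed.

Lemma taylor_rem_le (N : nat) (D : nat -> R -> R) (x : R) :
  abs_mono_seq a b D -> a <= x < b -> taylor_rem N D a x <= D O x.
Proof.
intros HD Hx; induction N; simpl; [lra|].
assert (0 <= D N a / INR (fact N) * (x - a) ^ N); [|lra].
apply Rmult_le_pos; [|apply pow_le; lra].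
apply Rdiv_le_0_compat; [apply HD; lra|apply INR_fact_lt_0].
Qed.

Lemma sum_n_taylor (D : nat -> R -> R) (x : R) (N : nat) :
  sum_n (fun k => D k a / INR (fact k) * (x - a) ^ k) N
  = D O x - taylor_rem (S N) D a x.
Proof.
induction N.
- rewrite sum_O; simpl; ring.
- rewrite sum_Sn, IHN. unfold plus; simpl; ring.
Qed.

Theorem abs_mono_taylor_series (D : nat -> R -> R) (x : R) :
  abs_mono_seq a b D -> a <= x < b ->
  is_series (fun k => D k a / INR (fact k) * (x - a) ^ k) (D O x).
Proof.
intros HD Hx.
(* [a + u] is the midpoint of [x] and [b], so [x = a + l * u] with [l < 1] and the remainder decays
   geometrically. *)
set (u := (x + b) / 2 - a).
assert (Hu : x - a < u) by (unfold u; lra).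
assert (Hub : a + u < b) by (unfold u; lra).
set (l := (x - a) / u).
assert (Hl : 0 <= l < 1).
{ split; [apply Rdiv_le_0_compat; lra|].
  apply Rmult_lt_reg_r with u; [lra|]. unfold l; field_simplify; lra. }
assert (Hx' : a + l * u = x) by (unfold l; field; lra).
assert (Hlim : is_lim_seq (fun N => taylor_rem (S N) D a x) 0).
{ apply is_lim_seq_le_le with (fun _ => 0) (fun N => l ^ S N * D O (a + u)).
  - intros N; split; [apply taylor_rem_nonneg; auto|].
    rewrite <- Hx' at 1.
    eapply Rle_trans; [apply taylor_rem_scale; auto; lra|].
    apply Rmult_le_compat_l; [apply pow_le; lra|].
    apply taylor_rem_le; auto; lra.
  - apply is_lim_seq_const.
  - replace (Finite 0) with (Rbar_mult 0 (D O (a + u))) by (simpl; f_equal; ring).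
    apply is_lim_seq_scal_r. apply -> is_lim_seq_incr_1.
    apply is_lim_seq_geom. rewrite Rabs_pos_eq; lra. }
change (is_lim_seq (sum_n (fun k => D k a / INR (fact k) * (x - a) ^ k)) (D O x)).
apply is_lim_seq_ext with (fun N => D O x - taylor_rem (S N) D a x).
{ intros N; symmetry; apply sum_n_taylor. }
replace (Finite (D O x)) with (Finite (D O x - 0)) by (f_equal; ring).
apply is_lim_seq_minus'; [apply is_lim_seq_const|exact Hlim].
Qed.

End Bernstein.

(* [ring] does not see through the carriers of Coquelicot's algebraic structures. *)
Ltac Cring := match goal with |- @eq _ ?x ?y => change (@eq C x y) end; ring.

(** * Complex series: real parts, bounds, uniqueness *)

Notation is_Cseries := (is_series (K := C_AbsRing) (V := C_NormedModule)).

Lemma is_series_Re (u : nat -> C) (l : C) :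
  is_Cseries u l -> is_series (fun k => Re (u k)) (Re l).
Proof.
intros H.
apply (filterlim_ext (fun n => Re (sum_n (G := C_AbelianMonoid) u n))).
{ intros n; induction n; [now rewrite !sum_O|].
  rewrite !sum_Sn, <- IHn; reflexivity. }
eapply filterlim_comp; [exact H|].
intros P [eps HP]; exists eps; intros y Hy; apply HP, Hy.
Qed.

Lemma sum_n_RtoC (u : nat -> R) (n : nat) :
  sum_n (G := C_AbelianMonoid) (fun k => RtoC (u k)) n = RtoC (sum_n u n).
Proof.
induction n; [now rewrite !sum_O|].
rewrite !sum_Sn, IHn. unfold plus; simpl. now rewrite RtoC_plus.
Qed.

Lemma is_series_RtoC (u : nat -> R) (l : R) :
  is_series u l -> is_Cseries (fun k => RtoC (u k)) (RtoC l).
Proof.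
intros H.
apply (filterlim_ext (fun n => RtoC (sum_n u n))).
{ intros n; symmetry; apply sum_n_RtoC. }
eapply filterlim_comp; [exact H|].
intros P [eps HP]; exists eps; intros y Hy; apply HP.
split; [exact Hy|apply ball_center].
Qed.

Lemma Cmod_series_le (u : nat -> C) (v : nat -> R) (l : C) (m : R) :
  is_Cseries u l -> is_series v m -> (forall k, Cmod (u k) <= v k) -> Cmod l <= m.
Proof.
intros Hu Hv Huv.
assert (H : Rbar_le (Cmod l) m); [|exact H].
apply (is_lim_seq_le (fun n => Cmod (sum_n (G := C_AbelianMonoid) u n)) (sum_n v)).
- intros n. eapply Rle_trans; [apply (norm_sum_n_m (V := C_NormedModule))|].
  apply sum_n_m_le, Huv.
- eapply filterlim_comp; [exact Hu|].
  apply (filterlim_norm (V := C_NormedModule)).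
- exact Hv.
Qed.

Lemma is_Cseries_of_error (u : nat -> C) (l : C) (e : nat -> R) :
  (forall N, Cmod (l - sum_n (G := C_AbelianMonoid) u N)%C <= e N) ->
  is_lim_seq e 0 -> is_Cseries u l.
Proof.
intros Hu He P [eps HP].
specialize (He (fun y => Rabs (y - 0) < eps)).
destruct He as [N HN]; [now exists eps|].
exists N; intros n Hn; apply HP, C_NormedModule_mixin_compat1.
specialize (HN n Hn). specialize (Hu n).
rewrite Rminus_0_r in HN. pose proof (Rle_abs (e n)).
eapply Rle_lt_trans; [|eapply Rle_lt_trans; [exact H|exact HN]].
eapply Rle_trans; [|exact Hu].
assert (Hsym : forall x y : C, Cmod (x - y)%C = Cmod (y - x)%C).
{ intros x y; rewrite <- Cmod_opp; f_equal; ring. }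
apply Req_le, Hsym.
Qed.

Lemma is_Cseries_unique (u : nat -> C) (l m : C) :
  is_Cseries u l -> is_Cseries u m -> l = m.
Proof. apply (filterlim_locally_unique (V := C_NormedModule)). Qed.

Lemma locally_Cmod_lt (z : C) (r : R) :
  0 < r -> locally z (fun z' => Cmod (z' - z)%C < r).
Proof.
intros Hr.
assert (Hs : 0 < sqrt 2) by (apply sqrt_lt_R0; lra).
(* Balls of [C] are squares; the one of half-side [r / sqrt 2] lies in the disc of radius [r]. *)
exists (mkposreal _ (Rdiv_lt_0_compat _ _ Hr Hs)). intros z' Hz'.
apply C_NormedModule_mixin_compat2 in Hz'. simpl pos in Hz'.
replace r with (sqrt 2 * (r / sqrt 2)) by (field; lra). exact Hz'.
Qed.

(** * Divided powers and the binomial theorem *)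

(** With divided powers, Taylor coefficients are plain derivatives and binomial coefficients are all
    1. *)
Definition dpow (k : nat) (z : C) : C := (RtoC (/ INR (fact k)) * z ^ k)%C.

Lemma dpow_0 (z : C) : dpow 0 z = RtoC 1.
Proof. unfold dpow; simpl. rewrite Rinv_1; ring. Qed.

Lemma dpow_S (k : nat) (z : C) : (RtoC (INR (S k)) * dpow (S k) z)%C = (z * dpow k z)%C.
Proof.
unfold dpow. rewrite Cpow_S, fact_simpl, mult_INR.
pose proof (INR_fact_neq_0 k). pose proof (not_0_INR (S k) ltac:(lia)).
transitivity (RtoC (INR (S k) * / (INR (S k) * INR (fact k))) * (z * z ^ k))%C.
- rewrite RtoC_mult; ring.
- replace (INR (S k) * / (INR (S k) * INR (fact k))) with (/ INR (fact k))
    by (field; auto).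
  ring.
Qed.

Lemma dpow_RtoC (k : nat) (x : R) : dpow k (RtoC x) = RtoC (x ^ k / INR (fact k)).
Proof. unfold dpow, Rdiv. rewrite <- RtoC_pow, <- RtoC_mult; f_equal; ring. Qed.

Lemma Cmod_dpow (k : nat) (z : C) : Cmod (dpow k z) = Cmod z ^ k / INR (fact k).
Proof.
unfold dpow, Rdiv. rewrite Cmod_mult, Cmod_pow, Cmod_R, Rabs_pos_eq; [ring|].
apply Rlt_le, Rinv_0_lt_compat, INR_fact_lt_0.
Qed.

(* The terms of order at least [N] in [h] in the binomial expansion of
   [dpow (N + j) (w + h)]. *)
Definition binom_tail (j N : nat) (w h : C) : C :=
  sum_n (G := C_AbelianMonoid) (fun m => dpow (j - m) w * dpow (N + m) h)%C j.

(** The term [m = 0] splits off and the others reindex; this removes one more Taylor term in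
    [taylor_ext_rem_series]. *)
Lemma binom_tail_S (j N : nat) (w h : C) :
  binom_tail (S j) N w h = (dpow (S j) w * dpow N h + binom_tail j (S N) w h)%C.
Proof.
unfold binom_tail, sum_n. rewrite sum_Sn_m by lia.
rewrite <- sum_n_m_S. unfold plus; simpl. rewrite Nat.add_0_r. f_equal.
apply sum_n_m_ext; intros m. now rewrite Nat.add_succ_r.
Qed.

Lemma binom_tail_0 (j : nat) (w h : C) : binom_tail j 0 w h = dpow j (w + h)%C.
Proof.
induction j as [|j IH].
- unfold binom_tail; rewrite sum_O; simpl. rewrite !dpow_0; Cring.
- assert (Hj : RtoC (INR (S j)) <> 0%C).
  { intros H; apply RtoC_inj in H; revert H; apply not_0_INR; lia. }
  enough (H : (RtoC (INR (S j)) * binom_tail (S j) 0 w h)%C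
            = (RtoC (INR (S j)) * dpow (S j) (w + h))%C).
  { transitivity (/ RtoC (INR (S j)) * (RtoC (INR (S j)) * binom_tail (S j) 0 w h))%C;
      [field; auto|rewrite H; field; auto]. }
  rewrite dpow_S, <- IH.
  (* The factor [j + 1] is split as [(j + 1 - m) + m]; [dpow_S] absorbs each part into a divided
     power, leaving [w] or [h] times the sum for [j]. *)
  transitivity (plus (G := C_AbelianMonoid)
    (sum_n (G := C_AbelianMonoid)
       (fun m => RtoC (INR (S j - m)) * dpow (S j - m) w * dpow m h)%C (S j))
    (sum_n (G := C_AbelianMonoid)
       (fun m => dpow (S j - m) w * (RtoC (INR m) * dpow m h))%C (S j))).
  { rewrite <- (sum_n_plus (G := C_AbelianMonoid)). unfold binom_tail.
    transitivity (sum_n (G := C_AbelianMonoid)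
      (fun m => RtoC (INR (S j)) * (dpow (S j - m) w * dpow (0 + m) h))%C (S j)).
    { symmetry; apply (sum_n_mult_l (K := C_Ring)). }
    apply sum_n_ext_loc; intros m Hm.
    replace (INR (S j)) with (INR (S j - m) + INR m)
      by (rewrite <- plus_INR; f_equal; lia).
    rewrite RtoC_plus. unfold plus; cbn -[INR dpow Nat.sub]. Cring. }
  (* The last term of the first sum and the first term of the second carry a factor zero. *)
  rewrite sum_Sn.
  unfold sum_n at 2. rewrite sum_Sn_m, <- sum_n_m_S by lia.
  fold (sum_n (G := C_AbelianMonoid)
    (fun m => dpow (S j - S m) w * (RtoC (INR (S m)) * dpow (S m) h))%C j).
  rewrite (sum_n_ext_loc _ (fun m => w * (dpow (j - m) w * dpow (0 + m) h))%C).
  2:{ intros m Hm. replace (S j - m)%nat with (S (j - m)) by lia.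
      transitivity (RtoC (INR (S (j - m))) * dpow (S (j - m)) w * dpow m h)%C;
        [reflexivity|rewrite dpow_S; simpl; Cring]. }
  rewrite (sum_n_ext (fun m => dpow (S j - S m) w * (RtoC (INR (S m)) * dpow (S m) h))%C
    (fun m => h * (dpow (j - m) w * dpow (0 + m) h))%C).
  2:{ intros m. transitivity (dpow (j - m) w * (RtoC (INR (S m)) * dpow (S m) h))%C;
        [reflexivity|rewrite dpow_S; simpl; Cring]. }
  rewrite !(sum_n_mult_l (K := C_Ring)).
  rewrite Nat.sub_diag.
  change ((w * binom_tail j 0 w h + RtoC 0 * dpow 0 w * dpow (S j) h
    + (dpow (S j) w * (RtoC 0 * dpow 0 h) + h * binom_tail j 0 w h))%C
    = ((w + h) * binom_tail j 0 w h)%C).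
  ring.
Qed.

Lemma Cmod_binom_tail (j N : nat) (w h : C) :
  Cmod (binom_tail j N w h)
  <= Re (binom_tail j N (RtoC (Cmod w)) (RtoC (Cmod h))).
Proof.
unfold binom_tail.
rewrite (sum_n_ext _ (fun m => RtoC (Cmod w ^ (j - m) / INR (fact (j - m))
   * (Cmod h ^ (N + m) / INR (fact (N + m)))))
   j (fun m => eq_trans (f_equal2 Cmult (dpow_RtoC _ _) (dpow_RtoC _ _))
        (eq_sym (RtoC_mult _ _)))).
rewrite sum_n_RtoC. simpl Re.
eapply Rle_trans; [apply (norm_sum_n_m (V := C_NormedModule))|].
apply sum_n_m_le; intros m.
change (Cmod (dpow (j - m) w * dpow (N + m) h) <=
  Cmod w ^ (j - m) / INR (fact (j - m)) * (Cmod h ^ (N + m) / INR (fact (N + m)))).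
rewrite Cmod_mult, !Cmod_dpow; apply Rle_refl.
Qed.

(** * Complex Taylor sums and their recentring *)

(** [iota] makes the sum a total function; its value is meaningful only where the series
    converges. *)
Definition taylor_ext (D : nat -> R -> R) (a : R) (z : C) : C :=
  iota (T := CompleteNormedModule.CompleteSpace C_AbsRing C_CompleteNormedModule)
    (is_Cseries (fun k => RtoC (D k a) * dpow k (z - RtoC a))%C).

Section Recentering.
Variables a b : R.

(** The moduli of the terms form the real Taylor series at [a + |z - a|], which converges. *)
Lemma taylor_ext_spec (D : nat -> R -> R) (z : C) :
  abs_mono_seq a b D -> Cmod (z - RtoC a)%C < b - a ->
  is_Cseries (fun k => RtoC (D k a) * dpow k (z - RtoC a))%C (taylor_ext D a z).
Proof.
intros HD Hz. pose proof (Cmod_ge_0 (z - RtoC a)%C) as Hz0.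
destruct (ex_series_le (V := C_CompleteNormedModule)
  (fun k => RtoC (D k a) * dpow k (z - RtoC a))%C
  (fun k => D k a / INR (fact k) * (a + Cmod (z - RtoC a)%C - a) ^ k)) as [l Hl].
- intros k. change (Cmod (RtoC (D k a) * dpow k (z - RtoC a))
    <= D k a / INR (fact k) * (a + Cmod (z - RtoC a) - a) ^ k).
  rewrite Cmod_mult, Cmod_dpow, Cmod_R, Rabs_pos_eq by (apply HD; lra).
  rewrite Rplus_minus_l. apply Req_le; unfold Rdiv; ring.
- eexists; apply abs_mono_taylor_series with b; [exact HD|lra].
- unfold taylor_ext; rewrite (iota_unique (V := C_CompleteNormedModule) _ l); auto.
  intros m Hm; exact (is_Cseries_unique _ _ _ Hm Hl).
Qed.

Lemma taylor_ext_RtoC (D : nat -> R -> R) (x : R) :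
  abs_mono_seq a b D -> a <= x < b -> taylor_ext D a (RtoC x) = RtoC (D O x).
Proof.
intros HD Hx. eapply is_Cseries_unique.
- apply taylor_ext_spec; [exact HD|].
  rewrite <- RtoC_minus, Cmod_R, Rabs_pos_eq; lra.
- eapply is_series_ext;
    [|apply is_series_RtoC, abs_mono_taylor_series with b; [exact HD|exact Hx]].
  intros k; cbv beta.
  rewrite <- RtoC_minus, dpow_RtoC, <- RtoC_mult. f_equal; unfold Rdiv; ring.
Qed.

(** The sum for the sequence shifted by [N] stands for the derivative of order [N] at [z]. *)
Fixpoint taylor_ext_rem (N : nat) (D : nat -> R -> R) (z z' : C) : C :=
  match N with
  | O => taylor_ext D a z'
  | S N => taylor_ext_rem N D z z'
           - taylor_ext (fun n => D (N + n)%nat) a z * dpow N (z' - z)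
  end%C.

(** Expand each [dpow k (z' - a)] in powers of [z' - z] and drop the orders below [N]: terms with
    [k < N] disappear, and [k = N + j] leaves [binom_tail j N]. *)
Lemma taylor_ext_rem_series (N : nat) (D : nat -> R -> R) (z z' : C) :
  abs_mono_seq a b D -> Cmod (z - RtoC a)%C + Cmod (z' - z)%C < b - a ->
  is_Cseries (fun j => RtoC (D (N + j)%nat a) * binom_tail j N (z - RtoC a) (z' - z))%C
    (taylor_ext_rem N D z z').
Proof.
intros HD Hz. induction N as [|N IH].
- simpl. eapply is_series_ext; [|apply taylor_ext_spec; [exact HD|]].
  + intros j; cbv beta. rewrite binom_tail_0; do 2 f_equal; ring.
  + replace (z' - RtoC a)%C with ((z - RtoC a) + (z' - z))%C by ring.
    eapply Rle_lt_trans; [apply Cmod_triangle|exact Hz].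
- pose proof (is_series_scal (K := C_AbsRing) (V := C_NormedModule)
    (dpow N (z' - z)) _ _
    (taylor_ext_spec (fun n => D (N + n)%nat) z (abs_mono_seq_tail a b D N HD)
      ltac:(pose proof (Cmod_ge_0 (z' - z)%C); lra))) as H.
  pose proof (is_series_minus _ _ _ _ IH H) as H1; cbv beta in H1.
  apply (is_series_ext (fun j => minus
    (RtoC (D (N + S j)%nat a) * binom_tail (S j) N (z - RtoC a) (z' - z))%C
    (scal (dpow N (z' - z)) (RtoC (D (N + S j)%nat a) * dpow (S j) (z - RtoC a))%C))).
  { intros j. rewrite binom_tail_S, Nat.add_succ_r; simpl.
    unfold minus, plus, opp, scal; simpl; unfold mult; simpl; Cring. }
  (* The term [j = 0] cancels, so the series may start at [j = 1], which becomes index [0] at order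
     [S N]. *)
  apply (is_series_incr_1 (fun j => minus
    (RtoC (D (N + j)%nat a) * binom_tail j N (z - RtoC a) (z' - z))%C
    (scal (dpow N (z' - z)) (RtoC (D (N + j)%nat a) * dpow j (z - RtoC a))%C))).
  evar_last; [exact H1|].
  unfold binom_tail; rewrite sum_O, !Nat.add_0_r.
  unfold minus, plus, opp, scal; simpl; unfold mult; simpl; Cring.
Qed.

Lemma taylor_ext_rem_RtoC (N : nat) (D : nat -> R -> R) (x y : R) :
  abs_mono_seq a b D -> a <= x < b -> a <= y < b ->
  taylor_ext_rem N D (RtoC x) (RtoC y) = RtoC (taylor_rem N D x y).
Proof.
intros HD Hx Hy; induction N as [|N IH]; simpl.
- now apply taylor_ext_RtoC.
- rewrite IH, taylor_ext_RtoC by (auto using abs_mono_seq_tail).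
  rewrite <- RtoC_minus, dpow_RtoC, <- RtoC_mult, <- RtoC_minus, Nat.add_0_r.
  f_equal; unfold Rdiv; ring.
Qed.

Lemma taylor_ext_rem_sum (N : nat) (D : nat -> R -> R) (z z' : C) :
  taylor_ext_rem (S N) D z z'
  = (taylor_ext D a z' - sum_n (G := C_AbelianMonoid)
      (fun n => taylor_ext (fun m => D (n + m)%nat) a z * dpow n (z' - z)) N)%C.
Proof.
induction N as [|N IH]; [now rewrite sum_O|].
rewrite sum_Sn.
change (taylor_ext_rem (S (S N)) D z z') with
  (taylor_ext_rem (S N) D z z'
   - taylor_ext (fun n => D (S N + n)%nat) a z * dpow (S N) (z' - z))%C.
rewrite IH. unfold plus; simpl. ring.
Qed.

(* All terms of [taylor_ext_rem_series] are dominated by those at the real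
   points [x <= y], where the remainder is that of a convergent real series. *)
Theorem taylor_ext_recenter (D : nat -> R -> R) (z z' : C) :
  abs_mono_seq a b D -> Cmod (z - RtoC a)%C + Cmod (z' - z)%C < b - a ->
  is_Cseries (fun n => taylor_ext (fun m => D (n + m)%nat) a z * dpow n (z' - z))%C
    (taylor_ext D a z').
Proof.
intros HD Hz.
pose proof (Cmod_ge_0 (z - RtoC a)%C) as Hw0.
pose proof (Cmod_ge_0 (z' - z)%C) as Hh0.
set (x := a + Cmod (z - RtoC a)%C). set (y := x + Cmod (z' - z)%C).
assert (Hx : a <= x < b) by (unfold x; lra).
assert (Hy : a <= y < b) by (unfold y, x; lra).
assert (Hxa : (RtoC x - RtoC a)%C = RtoC (Cmod (z - RtoC a))).
{ rewrite <- RtoC_minus; f_equal; unfold x; ring. }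
assert (Hyx : (RtoC y - RtoC x)%C = RtoC (Cmod (z' - z))).
{ rewrite <- RtoC_minus; f_equal; unfold y; ring. }
apply is_Cseries_of_error with (fun N => taylor_rem (S N) D x y).
- intros N. rewrite <- taylor_ext_rem_sum.
  pose proof (taylor_ext_rem_series (S N) D (RtoC x) (RtoC y) HD) as Hreal.
  rewrite Hxa, Hyx, !Cmod_R, !Rabs_pos_eq in Hreal by assumption.
  apply is_series_Re in Hreal; [|exact Hz].
  rewrite taylor_ext_rem_RtoC in Hreal by assumption.
  eapply Cmod_series_le; [apply taylor_ext_rem_series; eassumption|exact Hreal|].
  intros j; cbv beta.
  rewrite Cmod_mult, Cmod_R, Rabs_pos_eq by (apply HD; lra).
  rewrite re_scal_l.
  apply Rmult_le_compat_l; [apply HD; lra|apply Cmod_binom_tail].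
(* The bound tends to zero because the real Taylor series centred at [x] sums to [D O y]. *)
- apply is_lim_seq_ext with (fun N => D O y
    - sum_n (fun k => D k x / INR (fact k) * (y - x) ^ k) N).
  { intros N; rewrite sum_n_taylor; ring. }
  replace (Finite 0) with (Finite (D O y - D O y)) by (f_equal; ring).
  apply is_lim_seq_minus'; [apply is_lim_seq_const|].
  apply (abs_mono_taylor_series x b D y); [|unfold y, x; lra].
  apply (abs_mono_seq_sub a); [exact HD|lra].
Qed.

(** Agreement near [z] suffices, which allows an [F] whose centre of expansion varies with the
    point. *)
Lemma analytic_at_taylor_ext (D : nat -> R -> R) (F : C -> C) (z : C) :
  abs_mono_seq a b D -> Cmod (z - RtoC a)%C < b - a ->
  locally z (fun z' => F z' = taylor_ext D a z') -> analytic_at F z.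
Proof.
intros HD Hz HF.
exists (fun n => taylor_ext (fun m => D (n + m)%nat) a z * RtoC (/ INR (fact n)))%C.
assert (Hr : 0 < b - a - Cmod (z - RtoC a)%C) by lra.
generalize (filter_and _ _ HF (locally_Cmod_lt z _ Hr)). apply filter_imp.
intros z' [-> Hz'].
eapply is_series_ext; [|apply (taylor_ext_recenter D z z' HD); lra].
intros n.
change (taylor_ext (fun m => D (n + m)%nat) a z * dpow n (z' - z)
  = pow_n (K := C_Ring) (z' - z) n
    * (taylor_ext (fun m => D (n + m)%nat) a z * RtoC (/ INR (fact n))))%C.
replace (pow_n (K := C_Ring) (z' - z)%C n) with ((z' - z) ^ n)%C
  by (induction n; [reflexivity|rewrite Cpow_S, IHn; reflexivity]).
unfold dpow; ring.
Qed.

End Recentering.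

(** At the real point [c] the recentred coefficients are the [D n c], so both sides are sums of one
    series. *)
Lemma taylor_ext_center (a b c : R) (D : nat -> R -> R) (z : C) :
  abs_mono_seq a b D -> a <= c -> Cmod (z - RtoC c)%C < b - c ->
  taylor_ext D c z = taylor_ext D a z.
Proof.
intros HD Hc Hz. pose proof (Cmod_ge_0 (z - RtoC c)%C) as Hz0.
eapply is_Cseries_unique.
- apply taylor_ext_spec with b; [|exact Hz]. now apply abs_mono_seq_sub with a.
- eapply is_series_ext; [|apply (taylor_ext_recenter a b D (RtoC c) z HD)].
  + intros n; cbv beta.
    rewrite (taylor_ext_RtoC a b) by (auto using abs_mono_seq_tail; lra).
    now rewrite Nat.add_0_r.
  + rewrite <- RtoC_minus, Cmod_R, Rabs_pos_eq; lra.
Qed.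

(** * Relative derivatives and sequences of derivatives *)

Lemma is_derive_of_D_in (I : R -> Prop) (f d : R -> R) (x : R) :
  locally x I -> D_in f d I x -> is_derive f x (d x).
Proof.
intros [r Hr] H. apply is_derive_Reals. intros eps Heps.
destruct (H eps Heps) as (alp & Halp & Hlim).
exists (mkposreal _ (Rmin_pos _ _ (cond_pos r) Halp)). intros h Hh0 Hh; simpl in Hh.
specialize (Hlim (x + h)). simpl in Hlim. unfold Rdist in Hlim.
rewrite !Rplus_minus_l in Hlim. apply Hlim.
split; [split; [|lra]|].
- apply Hr. change (Rabs (x + h - x) < r). rewrite Rplus_minus_l.
  eapply Rlt_le_trans; [exact Hh|apply Rmin_l].
- eapply Rlt_le_trans; [exact Hh|apply Rmin_r].
Qed.

Lemma abs_mono_seq_of_D_in (I : R -> Prop) (a b : R) (D : nat -> R -> R) :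
  (forall x, a <= x < b -> locally x I) ->
  (forall n x, I x -> D_in (D n) (D (S n)) I x) ->
  (forall n x, I x -> 0 <= D n x) -> abs_mono_seq a b D.
Proof.
intros HI Hd Hp n x Hx.
specialize (HI x Hx). pose proof (locally_singleton _ _ HI) as HIx.
assert (Hder : is_derive (D n) x (D (S n) x)).
{ apply is_derive_of_D_in with I; auto. }
split; [auto|split; [|auto]].
apply derivable_continuous_pt; exists (D (S n) x); apply is_derive_Reals, Hder.
Qed.

(* The mean value theorem gives the one-sided derivative at [a] from the
   continuity there of the next member of the sequence. *)
Lemma abs_mono_seq_D_in (a b : R) (D : nat -> R -> R) (n : nat) (x : R) :
  abs_mono_seq a b D -> a <= x < b ->
  D_in (D n) (D (S n)) (fun t => a <= t < b) x.
Proof.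
intros HD Hx eps Heps.
destruct (HD (S n) x Hx) as (_ & Hc & _).
destruct (proj1 (continuity_pt_locally _ _) Hc (mkposreal eps Heps)) as [r Hr].
exists r; split; [apply cond_pos|]. intros y [[Hy Hyx] Hdist].
simpl in Hdist |- *; unfold Rdist in Hdist |- *.
destruct (MVT_gen (D n) x y (D (S n))) as (c & Hc1 & Hc2).
- intros t Ht; apply HD; revert Ht; unfold Rmin, Rmax; destruct Rle_dec; lra.
- intros t Ht; apply HD; revert Ht; unfold Rmin, Rmax; destruct Rle_dec; lra.
- rewrite Hc2. replace (D (S n) c * (y - x) / (y - x)) with (D (S n) c) by (field; lra).
  apply Hr. change (Rabs (c - x) < r). eapply Rle_lt_trans; [|exact Hdist].
  revert Hc1; unfold Rmin, Rmax, Rabs; repeat destruct Rle_dec; repeat destruct Rcase_abs; lra.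
Qed.

(** * Closing the interval at its left endpoint *)

Section LeftEndpoint.
Variables (a b : R) (D : nat -> R -> R).
Hypothesis Hab : a < b.
Hypothesis HD : forall c, a < c -> abs_mono_seq c b D.

Lemma abs_mono_seq_nondecreasing (n : nat) (x y : R) :
  a < x -> x <= y < b -> D n x <= D n y.
Proof.
intros Hx Hy. destruct (Req_dec x y) as [->|Hxy]; [lra|].
destruct (MVT_gen (D n) x y (D (S n))) as (c & Hc1 & Hc2).
- intros t; rewrite Rmin_left, Rmax_right by lra; intros Ht.
  apply (HD ((a + x) / 2) ltac:(lra) n t); lra.
- intros t; rewrite Rmin_left, Rmax_right by lra; intros Ht.
  apply (HD x Hx n t); lra.
- rewrite Rmin_left, Rmax_right in Hc1 by lra.
  destruct (HD x Hx (S n) c ltac:(lra)) as (Hp & _).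
  assert (0 <= D (S n) c * (y - x)) by (apply Rmult_le_pos; lra). lra.
Qed.

(** By monotonicity this infimum is the limit of [D n] at [a] from the right. *)
Definition right_value (n : nat) : R :=
  real (Glb_Rbar (fun y => exists x, a < x < b /\ y = D n x)).

Lemma right_value_spec (n : nat) :
  0 <= right_value n /\ (forall x, a < x < b -> right_value n <= D n x) /\
  (forall eps, 0 < eps -> exists x, a < x < b /\ D n x < right_value n + eps).
Proof.
unfold right_value.
set (E := fun y => exists x, a < x < b /\ y = D n x).
destruct (Glb_Rbar_correct E) as [Hlb Hglb].
assert (H0 : Rbar_le 0 (Glb_Rbar E)).
{ apply Hglb. intros y (x & Hx & ->). apply (HD x ltac:(lra) n x); lra. }
(* One element of [E] and the lower bound [0] make the infimum finite, so [real] does not return its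
   default. *)
assert (Hm : E (D n ((a + b) / 2))) by (exists ((a + b) / 2); split; [lra|auto]).
pose proof (Hlb _ Hm) as H1.
destruct (Glb_Rbar E) as [l| |]; simpl in *; try tauto.
split; [exact H0|split].
- intros x Hx; apply (Hlb (D n x)); exists x; auto.
- intros eps Heps. apply Classical_Prop.NNPP; intros Hno.
  assert (H2 : Rbar_le (l + eps) l); [|simpl in H2; lra].
  apply Hglb. intros y (x & Hx & ->). simpl.
  destruct (Rle_lt_dec (l + eps) (D n x)); [auto|].
  exfalso; apply Hno; exists x; auto.
Qed.

(** Being constant up to [a] gives the two-sided continuity there. *)
Definition left_closure (n : nat) (x : R) : R :=
  if Rlt_dec a x then D n x else right_value n.

Lemma left_closure_gt (n : nat) (x : R) : a < x -> left_closure n x = D n x.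
Proof. intros Hx; unfold left_closure; destruct Rlt_dec; [auto|lra]. Qed.

Lemma abs_mono_seq_left_closure : abs_mono_seq a b left_closure.
Proof.
intros n x Hx. destruct (right_value_spec n) as (H1 & H2 & H3).
destruct (Req_dec x a) as [->|Hxa].
- split; [|split; [|lra]].
  + unfold left_closure; destruct Rlt_dec; [lra|exact H1].
  + apply continuity_pt_locally. intros eps.
    (* One point [x0] with value near the infimum controls, by monotonicity, all points between [a]
       and [x0]. *)
    destruct (H3 eps (cond_pos eps)) as (x0 & Hx0 & Hlt).
    assert (Hr : 0 < x0 - a) by lra. exists (mkposreal _ Hr). intros y Hy.
    change (Rabs (y - a) < x0 - a) in Hy.
    unfold left_closure. destruct (Rlt_dec a a); [lra|].
    destruct (Rlt_dec a y).
    * rewrite Rabs_pos_eq in Hy by lra.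
      pose proof (H2 y ltac:(lra)).
      pose proof (abs_mono_seq_nondecreasing n y x0 ltac:(lra) ltac:(lra)).
      rewrite Rabs_pos_eq; lra.
    * rewrite Rminus_diag, Rabs_R0; apply cond_pos.
- assert (Hax : a < x) by lra.
  (* A base point strictly below [x] is taken to have the derivative at [x]. *)
  destruct (HD ((a + x) / 2) ltac:(lra) n x ltac:(lra)) as (H4 & _ & H5).
  assert (Hder : is_derive (left_closure n) x (left_closure (S n) x)).
  { rewrite left_closure_gt by exact Hax.
    apply is_derive_ext_loc with (D n); [|apply H5; lra].
    assert (Hr : 0 < x - a) by lra. exists (mkposreal _ Hr). intros y Hy.
    change (Rabs (y - x) < x - a) in Hy. apply Rabs_def2 in Hy.
    symmetry; apply left_closure_gt; lra. }
  split; [rewrite left_closure_gt by exact Hax; exact H4|split; [|auto]].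
  apply derivable_continuous_pt; exists (left_closure (S n) x).
  apply is_derive_Reals, Hder.
Qed.

End LeftEndpoint.

(** * Gluing discs over a half-plane *)

Section HalfPlane.
Variables (b : R) (D : nat -> R -> R).
Hypothesis HD : forall a, abs_mono_seq a b D.

(* With [x = Re z], [y = Im z] and [t = y^2 / (2 (b - x))] one has
   [t^2 + y^2 = t^2 + 2 (b - x) t < (b - x + t)^2]. *)
Definition disc_center (z : C) : R := Re z - Im z ^ 2 / (2 * (b - Re z)).

Lemma disc_center_spec (z : C) :
  Re z < b -> Cmod (z - RtoC (disc_center z))%C < b - disc_center z.
Proof.
intros Hz. unfold disc_center. set (t := Im z ^ 2 / (2 * (b - Re z))).
assert (Ht : 0 <= t).
{ apply Rdiv_le_0_compat; [apply pow2_ge_0|lra]. }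
assert (Ht2 : Im z ^ 2 = 2 * (b - Re z) * t) by (unfold t; field; lra).
rewrite <- (sqrt_pow2 (b - (Re z - t))) by lra.
unfold Cmod. apply sqrt_lt_1_alt.
replace (fst (z - RtoC (Re z - t))%C) with t by (simpl; unfold Re; ring).
replace (snd (z - RtoC (Re z - t))%C) with (Im z) by (simpl; unfold Im; ring).
rewrite Ht2. split; nra.
Qed.

Definition half_plane_ext (z : C) : C := taylor_ext D (disc_center z) z.

(** Of the two centres, the larger is a recentring of the smaller, so the choice of disc does not
    affect the value. *)
Lemma half_plane_ext_eq (c : R) (z : C) :
  Cmod (z - RtoC c)%C < b - c -> half_plane_ext z = taylor_ext D c z.
Proof.
intros Hz.
assert (Hre : Re z < b).
{ pose proof (re_le_Cmod (z - RtoC c)%C) as H.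
  pose proof (Rle_abs (Re (z - RtoC c)%C)) as H'.
  simpl in H'. unfold Re in *. simpl in H. lra. }
pose proof (disc_center_spec z Hre).
unfold half_plane_ext. destruct (Rle_lt_dec (disc_center z) c).
- symmetry; now apply taylor_ext_center with b.
- apply taylor_ext_center with b; auto; lra.
Qed.

Lemma analytic_at_half_plane_ext (z : C) :
  Re z < b -> analytic_at half_plane_ext z.
Proof.
intros Hz. pose proof (disc_center_spec z Hz) as Hc.
set (c := disc_center z) in *.
apply (analytic_at_taylor_ext c b D); [apply HD|exact Hc|].
(* The disc chosen for [z] also contains all nearby points, so one centre serves them all. *)
assert (Hr : 0 < b - c - Cmod (z - RtoC c)%C) by lra.
generalize (locally_Cmod_lt z _ Hr); apply filter_imp; intros z' Hz'.
apply half_plane_ext_eq.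
replace (z' - RtoC c)%C with ((z' - z) + (z - RtoC c))%C by ring.
eapply Rle_lt_trans; [apply Cmod_triangle|lra].
Qed.

Lemma half_plane_ext_RtoC (x : R) : x < b -> half_plane_ext (RtoC x) = RtoC (D O x).
Proof.
intros Hx. rewrite (half_plane_ext_eq x).
- apply taylor_ext_RtoC with b; [apply HD|lra].
- rewrite <- RtoC_minus, Rminus_diag, Cmod_R, Rabs_R0; lra.
Qed.

End HalfPlane.

(** * Entire extensions *)

Lemma analytic_taylor_ext_entire (c : R) (D : nat -> R -> R) :
  (forall b, abs_mono_seq c b D) -> analytic_on (fun _ => True) (taylor_ext D c).
Proof.
intros HD z _.
(* As [b] is free, the disc is made large enough to contain [z]. *)
apply (analytic_at_taylor_ext c (c + Cmod (z - RtoC c)%C + 1) D); [apply HD|lra|].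
now apply filter_forall.
Qed.

(** [x] may lie left of [c], out of reach of the real expansion at [c]; the base [a], left of both,
    links them. *)
Lemma taylor_ext_entire_RtoC (a c : R) (D : nat -> R -> R) (x : R) :
  (forall b, abs_mono_seq a b D) -> a <= c -> a <= x ->
  taylor_ext D c (RtoC x) = RtoC (D O x).
Proof.
intros HD Hc Hx. set (b := c + Rabs (x - c) + Rabs x + 1).
pose proof (Rle_abs (x - c)). pose proof (Rabs_pos x).
rewrite (taylor_ext_center a b c D).
- apply taylor_ext_RtoC with b; [apply HD|unfold b; lra].
- apply HD.
- exact Hc.
- rewrite <- RtoC_minus, Cmod_R. unfold b; lra.
Qed.

Theorem theorem2p1 :
  (forall (a b : R) (f : R -> R), a < b ->
     absolutely_monotone (fun x => a < x < b) f ->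
     exists F : C -> C,
       real_restriction (fun x => a < x < b) F f /\
       analytic_on (fun z => Cmod (z - RtoC a)%C < b - a) F /\
       exists g : R -> R,
         real_restriction (fun x => a <= x < b) F g /\
         absolutely_monotone (fun x => a <= x < b) g) /\
  (forall (b : R) (f : R -> R),
     absolutely_monotone (fun x => x < b) f ->
     exists F : C -> C,
       real_restriction (fun x => x < b) F f /\
       analytic_on (fun z => Re z < b) F) /\
  (forall (a : R) (f : R -> R),
     absolutely_monotone (fun x => a < x) f ->
     exists F : C -> C,
       real_restriction (fun x => a < x) F f /\
       analytic_on (fun _ => True) F) /\
  (forall f : R -> R,
     absolutely_monotone (fun _ => True) f ->
     exists F : C -> C,
       real_restriction (fun _ => True) F f /\
       analytic_on (fun _ => True) F).

Proof.
split; [|split; [|split]].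
- intros a b f Hab (D & Hf & Hd & Hp).
  assert (HD : forall c, a < c -> abs_mono_seq c b D).
  { intros c Hc. apply abs_mono_seq_of_D_in with (fun x => a < x < b); auto.
    intros x Hx. apply filter_and; [apply open_gt|apply open_lt]; lra. }
  (* Once closed at [a], the sequence can be expanded there, which reaches the whole disc. *)
  pose proof (abs_mono_seq_left_closure a b D Hab HD) as HE.
  set (E := left_closure a b D) in *.
  exists (taylor_ext E a). split; [|split; [|exists (E O); split]].
  + intros x Hx. rewrite (taylor_ext_RtoC a b) by (auto; lra).
    unfold E; rewrite left_closure_gt by lra. now rewrite Hf.
  + intros z Hz. apply (analytic_at_taylor_ext a b E); auto.
    now apply filter_forall.
  + intros x Hx. now apply taylor_ext_RtoC with b.
  + exists E; split; [auto|split].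
    * intros n x Hx. now apply abs_mono_seq_D_in.
    * intros n x Hx. now apply HE.
- intros b f (D & Hf & Hd & Hp).
  assert (HD : forall a, abs_mono_seq a b D).
  { intros a. apply abs_mono_seq_of_D_in with (fun x => x < b); auto.
    intros x Hx; apply open_lt; lra. }
  exists (half_plane_ext b D); split.
  + intros x Hx. rewrite half_plane_ext_RtoC by auto. now rewrite Hf.
  + intros z Hz. now apply analytic_at_half_plane_ext.
- intros a f (D & Hf & Hd & Hp).
  assert (HD : forall c b, a < c -> abs_mono_seq c b D).
  { intros c b Hc. apply abs_mono_seq_of_D_in with (fun x => a < x); auto.
    intros x Hx; apply open_gt; lra. }
  exists (taylor_ext D (a + 1)); split.
  (* The minimum of [a + 1] and [x] is a base left of both and still inside the interval. *)
  + intros x Hx. pose proof (Rmin_l (a + 1) x). pose proof (Rmin_r (a + 1) x).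
    rewrite (taylor_ext_entire_RtoC (Rmin (a + 1) x)) by
      (auto; intros; apply HD; apply Rmin_glb_lt; lra).
    now rewrite Hf.
  + apply analytic_taylor_ext_entire; intros b; apply HD; lra.
- intros f (D & Hf & Hd & Hp).
  assert (HD : forall a b, abs_mono_seq a b D).
  { intros a b. apply abs_mono_seq_of_D_in with (fun _ => True); auto.
    intros x Hx; now apply filter_forall. }
  exists (taylor_ext D 0); split.
  + intros x _. pose proof (Rmin_l 0 x). pose proof (Rmin_r 0 x).
    rewrite (taylor_ext_entire_RtoC (Rmin 0 x)) by auto.
    now rewrite Hf.
  + apply analytic_taylor_ext_entire; auto.
Qed.
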